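(* Let $X$ be a real Hilbert space, let $A\colon X\rightrightarrows X$ be a maximally monotone operator, and let $x,x^*\in X$. Then the following hold: (i) If $x^*\notin\overline{\operatorname{ran}}\,A$, then $\lim_{\gamma\to +\infty} C_{A,\gamma}(x,x^* )=+\infty$. (ii) If $x^*\in\operatorname{ran} A$, then $\lim_{\gamma\to +\infty} C_{A,\gamma}(x,x^* )=0$.
   Context: For $\gamma>0$, $J_{\gamma A}=(\mathrm{Id}+\gamma A)^{-1}$ denotes the resolvent of $\gamma A$, which is a single-valued map defined on all of $X$. The Carlier bound is $$C_{A,\gamma}(x,x^* ) := \frac{\|x-J_{\gamma A}(x+\gamma x^* )\|^2}{\gamma}.$$ $\operatorname{ran}A=\bigcup_{x\in X}Ax$ and $\overline{\operatorname{ran}}\,A$ is its norm closure. *)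

(* Defs.v *)
From mathcomp Require Import all_boot all_order all_algebra.
From mathcomp Require Import all_classical all_reals all_analysis.
Import Order.TTheory GRing.Theory Num.Theory.
Import numFieldNormedType.Exports.

Set Implicit Arguments.
Unset Strict Implicit.
Unset Printing Implicit Defensive.

Local Open Scope classical_set_scope.
Local Open Scope ring_scope.

(* A real Hilbert space is a complete normed module [X] over a [realType]
   together with an inner product [dot : {dot X for idfun}] inducing its norm. *)
Definition induces_norm (R : realType) (X : normedModType R)
    (dot : {dot X for idfun}) : Prop :=
  forall x : X, `|x| ^+ 2 = dot x x.

(* [A : X -> set X] is a set-valued operator; [A x u] says that [(x, u)] is in
   its graph. *)
Definition op_id (X : Type) : X -> set X := fun x => [set x].

Definition op_add (X : zmodType) (A B : X -> set X) : X -> set X :=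
  fun x => [set u + v | u in A x & v in B x].

Definition op_scale (R : realType) (X : lmodType R) (c : R) (A : X -> set X) :
    X -> set X :=
  fun x => [set c *: u | u in A x].

Definition op_inv (X : Type) (A : X -> set X) : X -> set X :=
  fun u => [set x | A x u].

Definition ran (X : Type) (A : X -> set X) : set X := \bigcup_(x in setT) A x.

Definition monotone (R : realType) (X : normedModType R)
    (dot : {dot X for idfun}) (A : X -> set X) : Prop :=
  forall x u y v : X, A x u -> A y v -> 0 <= dot (x - y) (u - v).

Definition maximally_monotone (R : realType) (X : normedModType R)
    (dot : {dot X for idfun}) (A : X -> set X) : Prop :=
  monotone dot A /\
  forall B : X -> set X,
    monotone dot B -> (forall x, A x `<=` B x) -> forall x, B x `<=` A x.

Definition resolvent (R : realType) (X : normedModType R)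
    (gamma : R) (A : X -> set X) : X -> set X :=
  op_inv (op_add (@op_id X) (op_scale gamma A)).

(* The resolvent as a map.  When [A] is maximally monotone and [0 < gamma], the
   set [resolvent gamma A z] is a singleton (Minty's theorem), so that [get]
   returns its unique element; in the other cases the value is irrelevant. *)
Definition resolvent_map (R : realType) (X : normedModType R)
    (gamma : R) (A : X -> set X) (z : X) : X :=
  get (resolvent gamma A z).

Definition carlier (R : realType) (X : normedModType R)
    (A : X -> set X) (gamma : R) (x xs : X) : R :=
  `|x - resolvent_map gamma A (x + gamma *: xs)| ^+ 2 / gamma.

(* Main.v *)
(* Minty's theorem makes the resolvent total: minimise the strongly convex
   function F(x,u) + (|x|^2 + |u|^2)/2, where F(x,u) = sup_{(y,v) in A}
   <x,v> + <y,u> - <y,v> is the Fitzpatrick function.  Completeness gives a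
   minimiser (x,u); since F >= <.,.> everywhere and F = <.,.> on the graph of A,
   the optimality condition says that (-u,-x) is monotonically related to A,
   hence lies in A, and then that u = -x.  So Id + A has a zero, and so does the
   translated and scaled operator that describes J_{gamma A}(z).

   Now let p = J_{gamma A}(x + gamma xs), so that x - p = gamma (v - xs) with
   v in A p.  The Carlier bound equals gamma |v - xs|^2, which gives (i).  If xs
   lies in A y, monotonicity gives <p - y, x - p> >= 0, hence |x - p| <= |x - y|
   and (ii). *)
Require Import Defs.
From mathcomp Require Import all_boot all_order all_algebra.
From mathcomp Require Import all_classical all_reals all_analysis.
From mathcomp Require Import ring lra.
Import Order.TTheory GRing.Theory Num.Theory.
Import numFieldNormedType.Exports.

Local Open Scope classical_set_scope.
Local Open Scope ring_scope.

Set Implicit Arguments.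
Unset Strict Implicit.
Unset Printing Implicit Defensive.

(** * Bilinear calculus and continuity of the inner product *)

Section InnerProduct.
Context {R : realType} {X : normedModType R} (dot : {dot X for idfun}).
Local Notation "''[' u , v ]" := (dot u v : R).

Lemma dotC (u v : X) : '[u, v] = '[v, u].
Proof. by have := hermC dot u v; rewrite expr0 mul1r. Qed.

Lemma dotDl (u v w : X) : '[u + v, w] = '[u, w] + '[v, w].
Proof. exact: linearDl. Qed.

Lemma dotZl (a : R) (u w : X) : '[a *: u, w] = a * '[u, w].
Proof. exact: linearZl_LR. Qed.

Lemma dotNl (u w : X) : '[- u, w] = - '[u, w].
Proof. by rewrite -scaleN1r dotZl mulN1r. Qed.

Lemma dotDr (u v w : X) : '[w, u + v] = '[w, u] + '[w, v].
Proof. by rewrite !(dotC w) dotDl. Qed.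

Lemma dotZr (a : R) (u w : X) : '[w, a *: u] = a * '[w, u].
Proof. by rewrite !(dotC w) dotZl. Qed.

Lemma dotNr (u w : X) : '[w, - u] = - '[w, u].
Proof. by rewrite !(dotC w) dotNl. Qed.

Definition dotE := (dotDl, dotDr, dotNl, dotNr, dotZl, dotZr).

Hypothesis hdot : induces_norm dot.

Lemma dotuu (u : X) : '[u, u] = `|u| ^+ 2.
Proof. by rewrite hdot. Qed.

Lemma dotuu_ge0 (u : X) : 0 <= '[u, u].
Proof. by rewrite dotuu sqr_ge0. Qed.

Lemma dotuu_eq0 (u : X) : '[u, u] <= 0 -> u = 0.
Proof.
rewrite dotuu => u0; apply/eqP; rewrite -normr_eq0 -sqrf_eq0 eq_le u0.
exact: sqr_ge0.
Qed.

Lemma cvg_norm2 (f : nat -> X) (u : X) :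
  f @ \oo --> u -> (`|f n| ^+ 2 : R) @[n --> \oo] --> (`|u| ^+ 2 : R).
Proof. by move=> fu; apply: cvgM; exact: cvg_norm. Qed.

Lemma cvg_dot (f : nat -> X) (u v : X) :
  f @ \oo --> u -> '[f n, v] @[n --> \oo] --> '[u, v].
Proof.
move=> fu.
(* Polarisation reduces continuity of the inner product to that of the norm. *)
have polar w : '[w, v] = (`|w + v| ^+ 2 - `|w| ^+ 2 - `|v| ^+ 2) / 2.
  by rewrite -!dotuu !dotE (dotC v w); field.
rewrite polar (_ : (fun n => _) = fun n =>
  (`|f n + v| ^+ 2 - `|f n| ^+ 2 - `|v| ^+ 2) / 2 : R); last first.
  by apply/funext => n; rewrite polar.
apply: cvgM; last exact: cvg_cst.
apply: cvgB; last exact: cvg_cst.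
apply: cvgB; last exact: cvg_norm2.
by apply: cvg_norm2; apply: cvgD => //; exact: cvg_cst.
Qed.

End InnerProduct.

(** * Minimisation of a closed convex function plus half the squared norm *)

Section StronglyConvexMinimum.
Context {R : realType} {X : completeNormedModType R} (dot : {dot X for idfun}).
Hypothesis hdot : induces_norm dot.
Local Notation "''[' u , v ]" := (dot u v : R).

Lemma cvg_of_sqr_dist (f : nat -> X) (c : R) :
  (forall n k, `|f n - f k| ^+ 2 <= c * (n.+1%:R^-1 + k.+1%:R^-1)) ->
  cvg (f @ \oo).
Proof.
move=> fc; apply: cauchy_cvg; apply: cauchy_exP => /= e e0.
have c0 : 0 <= c.
  have := fc 0%N 0%N; rewrite subrr normr0 expr0n /= invr1 => c0; lra.
(* For [n >= N] both inverses are at most that of [N.+1], whence [2 * c]; the [+ 1] keeps the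
   denominator positive when [c = 0]. *)
have d0 : 0 < e ^+ 2 / (2 * c + 1) by rewrite divr_gt0 ?exprn_gt0//; lra.
have [N _ NP] := near_infty_natSinv_lt (PosNum d0).
exists (f N); exists N => //= n /= Nn.
have {}NP : N.+1%:R^-1 < e ^+ 2 / (2 * c + 1) := NP N (leqnn N).
rewrite -ball_normE /= -(@ltr_pXn2r _ 2) ?nnegrE// ?(ltW e0)//.
apply: le_lt_trans (fc N n) _.
have nN : n.+1%:R^-1 <= N.+1%:R^-1 :> R by rewrite lef_pV2 ?posrE ?ler_nat.
have N0 : 0 < N.+1%:R^-1 :> R by rewrite invr_gt0.
move: NP; rewrite ltr_pdivlMr; last lra.
have := ler_wpM2l c0 nN.
by move: (N.+1%:R^-1 : R) (n.+1%:R^-1 : R) (e ^+ 2 : R) N0 => a b d; lra.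
Qed.

(** Stands for the epigraph of a closed convex function. The relational form covers the value [+oo],
    taken where no [t] is admissible. *)
Variable E : X -> X -> R -> Prop.
Hypothesis E_convex : forall (l : R) x u t x' u' t', 0 <= l <= 1 ->
  E x u t -> E x' u' t' ->
  E (x + l *: (x' - x)) (u + l *: (u' - u)) (t + l * (t' - t)).
Hypothesis E_closed : forall (f g : nat -> X) (h : nat -> R) x u t,
  (forall n, E (f n) (g n) (h n)) ->
  f @ \oo --> x -> g @ \oo --> u -> h @ \oo --> t -> E x u t.

Let q (x u : X) (t : R) : R := t + ('[x, x] + '[u, u]) / 2.

(** First-order optimality: compare the minimiser with points of the segment towards [(x', u', t')],
    at a parameter [l] small enough for the linear term to dominate the quadratic one. *)
Lemma convex_minimum_subgradient x u t : E x u t ->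
  (forall x' u' t', E x' u' t' -> q x u t <= q x' u' t') ->
  forall x' u' t', E x' u' t' -> t <= t' + '[x, x' - x] + '[u, u' - u].
Proof.
move=> Ex qmin x' u' t' Ex'.
have step (l : R) : 0 <= l <= 1 ->
    0 <= l * ((t' - t + '[x, x' - x] + '[u, u' - u])
    + l * (('[x' - x, x' - x] + '[u' - u, u' - u]) / 2)).
  move=> l01; have := qmin _ _ _ (E_convex l01 Ex Ex').
  rewrite -subr_ge0 /q !dotE (dotC dot x' x) (dotC dot u' u) => /le_trans; apply.
  by rewrite le_eqVlt; apply/orP; left; apply/eqP; field.
have dd0 := dotuu_ge0 hdot (x' - x); have du0 := dotuu_ge0 hdot (u' - u).
move: step dd0 du0; set a := '[x, x' - x]; set b := '[u, u' - u].
set c := '[x' - x, x' - x]; set d := '[u' - u, u' - u] => step c0 d0.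
rewrite leNgt; apply/negP => lt_t.
(* [s] is the supposed violation. With [l = s / r], [l * (c + d) = s - l * s < s], so
   [- s + l * (c + d) / 2] is negative, against [step]. *)
pose s := t - t' - a - b; pose r := c + d + s.
have s0 : 0 < s by rewrite /s; lra.
have r0 : 0 < r by rewrite /r; lra.
have l01 : 0 <= s / r <= 1.
  by rewrite divr_ge0 ?(ltW s0) ?(ltW r0)//= ler_pdivrMr// /r; lra.
have l0 : 0 < s / r by rewrite divr_gt0.
have := step _ l01; rewrite pmulr_rge0// leNgt => /negP; apply.
have : s / r * (c + d + s) = s by rewrite -/r divfK// gt_eqF.
have : 0 < s / r * s by rewrite mulr_gt0.
move: (s / r) => l; rewrite /s => *; nra.
Qed.

(** Strong convexity makes every minimising sequence Cauchy; completeness supplies the limit and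
    closedness of [E] keeps it admissible. *)
Lemma convex_minimum_exists (m : R) : (exists x u t, E x u t) ->
  (forall x u t, E x u t -> m <= q x u t) ->
  exists x u t, E x u t /\ forall x' u' t', E x' u' t' -> q x u t <= q x' u' t'.
Proof.
move=> [x0 [u0 [t0 Ex0]]] qm.
pose S := [set r | exists x u t, E x u t /\ r = q x u t].
have Slb : lbound S m by move=> _ [x [u [t [Ex ->]]]]; exact: qm.
have Sinf : has_inf S by split; [exists (q x0 u0 t0), x0, u0, t0|exists m].
have Sge x u t : E x u t -> inf S <= q x u t.
  by move=> Ex; apply: ge_inf; [exists m|exists x, u, t].
have /choice[w wP] (n : nat) : exists w : X * X * R,
    E w.1.1 w.1.2 w.2 /\ q w.1.1 w.1.2 w.2 < inf S + n.+1%:R^-1.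
  have n0 : 0 < n.+1%:R^-1 :> R by rewrite invr_gt0.
  have [_ [x [u [t [Ex ->]]]] lt] := inf_adherent n0 Sinf.
  by exists (x, u, t).
pose f n := (w n).1.1; pose g n := (w n).1.2; pose h n := (w n).2.
(* At the midpoint [q] is the average of its two values minus an eighth of the left side. As it is
   at least [inf S], the left side is at most [8 / 2 = 4] times the sum of the errors. *)
have dist n k : '[f n - f k, f n - f k] + '[g n - g k, g n - g k] <=
    4 * (n.+1%:R^-1 + k.+1%:R^-1).
  have [En qn] := wP n; have [Ek qk] := wP k.
  have h01 : 0 <= (2^-1 : R) <= 1 by lra.
  have := Sge _ _ _ (E_convex h01 Ek En).
  move: qn qk; rewrite -/(f n) -/(f k) -/(g n) -/(g k) -/(h n) -/(h k) /q.
  rewrite !dotE (dotC dot (f k) (f n)) (dotC dot (g k) (g n)).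
  move: '[f n, f n] '[f n, f k] '[f k, f k] '[g n, g n] '[g n, g k] '[g k, g k].
  by move: (n.+1%:R^-1 : R) (k.+1%:R^-1 : R) (inf S : R) => a b c *; lra.
have /cvg_ex[x fx] : cvg (f @ \oo).
  apply: (@cvg_of_sqr_dist _ 4) => n k; rewrite -(dotuu hdot).
  by apply: le_trans (dist n k); rewrite lerDl dotuu_ge0.
have /cvg_ex[u gu] : cvg (g @ \oo).
  apply: (@cvg_of_sqr_dist _ 4) => n k; rewrite -(dotuu hdot).
  by apply: le_trans (dist n k); rewrite lerDr dotuu_ge0.
have qcvg : q (f n) (g n) (h n) @[n --> \oo] --> inf S.
  apply: (@squeeze_cvgr _ _ _ _ (fun=> inf S) (fun n => inf S + n.+1%:R^-1)).
  - by apply: nearW => n; have [En qn] := wP n; rewrite Sge//= ltW.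
  - exact: cvg_cst.
  - rewrite -[X in _ --> X]addr0; apply: cvgD; first exact: cvg_cst.
    exact: cvg_harmonic.
(* The third coordinate converges because [q] and the squared norms do. *)
have hcvg : h @ \oo --> inf S - ('[x, x] + '[u, u]) / 2.
  rewrite (_ : h = fun n => q (f n) (g n) (h n)
                       - ('[f n, f n] + '[g n, g n]) / 2); last first.
    by apply/funext => n; rewrite /q addrK.
  apply: cvgB => //; apply: cvgM; last exact: cvg_cst.
  have norm2 (k : nat -> X) (v : X) : k @ \oo --> v ->
      '[k n, k n] @[n --> \oo] --> '[v, v].
    move=> kv; rewrite (dotuu hdot); under eq_fun do rewrite (dotuu hdot).
    exact: cvg_norm2.
  by apply: cvgD; exact: norm2.
exists x, u, (inf S - ('[x, x] + '[u, u]) / 2); split.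
  by apply: E_closed fx gu hcvg => n; have [] := wP n.
by move=> x' u' t' Ex'; rewrite {1}/q subrK; exact: Sge.
Qed.

End StronglyConvexMinimum.

(** * Minty's theorem through the Fitzpatrick function *)

Section Minty.
Context {R : realType} {X : completeNormedModType R} (dot : {dot X for idfun}).
Hypothesis hdot : induces_norm dot.
Local Notation "''[' u , v ]" := (dot u v : R).

Definition related (A : X -> set X) (p u : X) : Prop :=
  forall y v, A y v -> 0 <= '[p - y, u - v].

(** Adjoining the pair [(p, u)] to the graph keeps it monotone, so maximality puts it in [A]. *)
Lemma maximal_related (A : X -> set X) (p u : X) :
  maximally_monotone dot A -> related A p u -> A p u.
Proof.
move=> [mA maxA] pu.
pose B (x w : X) := A x w \/ (x = p /\ w = u).
suff mB : Defs.monotone dot B by apply: (maxA B mB) => [x w|]; [left|right].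
move=> x w y v [Axw|[-> ->]] [Ayv|[-> ->]].
- exact: mA.
- by rewrite -(opprB p) -(opprB u) dotNl dotNr opprK; exact: pu.
- exact: pu.
- by rewrite subrr -(scale0r u) dotZl mul0r.
Qed.

Section Zero.
Variable A : X -> set X.
Hypothesis A_monotone : Defs.monotone dot A.
(** Maximality in pointwise form, which transfers easily to a translated and scaled operator. *)
Hypothesis A_related : forall p u, related A p u -> A p u.

(* The epigraph of the Fitzpatrick function of [A]. *)
Let F (x u : X) (t : R) : Prop :=
  forall y v, A y v -> '[x, v] + '[y, u] - '[y, v] <= t.

Let F_ge_dot x u t : F x u t -> '[x, u] <= t.
Proof.
(* If [t < '[x, u]], then [F x u t] makes [(x, u)] related to [A], hence a point of the graph;
   testing [F x u t] there gives the contradiction. *)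
move=> Fx; rewrite leNgt; apply/negP => lt_t.
have Axu : A x u.
  apply: A_related => y v /Fx; rewrite !dotE; move: lt_t.
  by move: '[x, u] '[x, v] '[y, u] '[y, v] => a b c d *; lra.
by move: (Fx _ _ Axu); rewrite addrK leNgt lt_t.
Qed.

Let F_graph y v : A y v -> F y v '[y, v].
Proof.
move=> Ayv z w Azw; have := A_monotone Ayv Azw; rewrite !dotE.
by move: '[y, v] '[y, w] '[z, v] '[z, w] => a b c d *; lra.
Qed.

(** For fixed [(y, v)] the constraint is affine in [(x, u, t)]. *)
Let F_convex (l : R) x u t x' u' t' : 0 <= l <= 1 -> F x u t -> F x' u' t' ->
  F (x + l *: (x' - x)) (u + l *: (u' - u)) (t + l * (t' - t)).
Proof.
move=> /andP[l0 l1] Fx Fx' y v Ayv; have := Fx _ _ Ayv; have := Fx' _ _ Ayv.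
rewrite !dotE.
move: '[x, v] '[x', v] '[y, u] '[y, u'] '[y, v] => a b c d e h1 h2.
have : 0 <= l * (t' - (b + d - e)) by rewrite mulr_ge0// subr_ge0.
have : 0 <= (1 - l) * (t - (a + c - e)) by rewrite mulr_ge0// subr_ge0.
lra.
Qed.

Let F_closed (f g : nat -> X) (h : nat -> R) x u t :
  (forall n, F (f n) (g n) (h n)) ->
  f @ \oo --> x -> g @ \oo --> u -> h @ \oo --> t -> F x u t.
Proof.
move=> Fn fx gu ht y v Ayv.
have lhs : '[f n, v] + '[y, g n] - '[y, v] @[n --> \oo] -->
    '[x, v] + '[y, u] - '[y, v].
  apply: cvgB; last exact: cvg_cst.
  apply: cvgD; first exact: (cvg_dot hdot).
  rewrite dotC; under eq_fun do rewrite dotC.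
  exact: (cvg_dot hdot).
by apply: (ler_cvg_to lhs ht); apply: nearW => n; exact: Fn.
Qed.

Lemma exists_opp_in_graph : exists p, A p (- p).
Proof.
have [x [u [t [Fx qmin]]]] : exists x u t, F x u t /\ forall x' u' t',
    F x' u' t' -> t + ('[x, x] + '[u, u]) / 2 <= t' + ('[x', x'] + '[u', u']) / 2.
  (* The bound [m = 0] comes from [F_ge_dot]: the objective is at least half of
     ['[x + u, x + u]]. *)
  apply: (convex_minimum_exists hdot F_convex F_closed (m := 0)).
    have [[y [v Ayv]]|noA] := pselect (exists y v, A y v).
      by exists y, v, '[y, v]; exact: F_graph.
    by exists 0, 0, 0 => y v Ayv; case: noA; exists y, v.
  move=> x u t /F_ge_dot; have := dotuu_ge0 hdot (x + u).
  rewrite !dotE (dotC dot u x).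
  by move: '[x, x] '[x, u] '[u, u] => a b c *; lra.
have grad := convex_minimum_subgradient hdot F_convex Fx qmin.
(* Optimality against the point [(y, v, '[y, v])] of the epigraph, combined with ['[x, u] <= t]. *)
have key y v : A y v -> '[x + u, x + u] <= '[- u - y, - x - v].
  move=> /F_graph /grad; have := F_ge_dot Fx.
  rewrite !dotE (dotC dot u x) (dotC dot y x).
  move: '[x, x] '[x, u] '[u, u] '[x, y] '[u, v] '[y, v] => a b c d e f.
  by move=> *; lra.
have Aux : A (- u) (- x).
  by apply: A_related => y v /key; apply: le_trans; exact: dotuu_ge0.
(* Testing [key] at [(- u, - x)] itself makes its right side vanish, so [x + u = 0]. *)
have := key _ _ Aux; rewrite subrr -{1}(scale0r u) dotZl mul0r.
move=> /(dotuu_eq0 hdot)/eqP; rewrite addr_eq0 => /eqP xu.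
by exists x; rewrite {1}xu.
Qed.

End Zero.

Lemma resolvent_nonempty (A : X -> set X) (gamma : R) (z : X) :
  maximally_monotone dot A -> 0 < gamma -> resolvent gamma A z !=set0.
Proof.
move=> hA g0.
(* [B] is [gamma A - z], so [- p] in [B p] says that [z] lies in [p + gamma A p]. *)
pose B (y : X) : set X := fun u => A y (gamma^-1 *: (u + z)).
have [p Bp] : exists p, B p (- p).
  have scaled (y y' u u' : X) : '[y - y', gamma^-1 *: (u + z) - gamma^-1 *: (u' + z)]
      = gamma^-1 * '[y - y', u - u'].
    by rewrite -scalerBr dotZr opprD addrACA subrr addr0.
  have gV0 : 0 < gamma^-1 by rewrite invr_gt0.
  apply: exists_opp_in_graph => [y u y' u' By By'|p u pu].
    by rewrite -(pmulr_rge0 _ gV0) -scaled; exact: hA.1.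
  apply: maximal_related hA _ => y v Ayv.
  have := pu y (gamma *: v - z); rewrite /B subrK scalerK ?gt_eqF// => /(_ Ayv).
  rewrite -(pmulr_rge0 _ gV0) -scaled.
  by rewrite subrK scalerK ?gt_eqF.
exists p; rewrite /resolvent /op_inv /op_add /=.
exists p => //; exists (z - p); last by rewrite addrC subrK.
exists (gamma^-1 *: (z - p)); first by rewrite addrC.
by rewrite scalerKV ?gt_eqF.
Qed.

End Minty.

(** * The two limits of the Carlier bound *)

Section CarlierBound.
Context {R : realType} {X : completeNormedModType R} {dot : {dot X for idfun}}.
Hypothesis hdot : induces_norm dot.
Variable A : X -> set X.
Hypothesis hA : maximally_monotone dot A.
Variables x xs : X.

Lemma carlier_witness (gamma : R) : 0 < gamma -> exists p v,
  [/\ A p v, x - p = gamma *: (v - xs) &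
      carlier A gamma x xs = `|x - p| ^+ 2 / gamma].
Proof.
move=> g0; rewrite /carlier /resolvent_map.
have := getPex (resolvent_nonempty hdot (x + gamma *: xs) hA g0).
set p := get _ => -[_ -> [_ [v Av <-] pv]].
exists p, v; split => //; rewrite scalerBr.
by apply/eqP; rewrite subr_eq addrAC -subr_eq opprK -pv addrC.
Qed.

Lemma carlier_cvg_pinfty : ~ closure (ran A) xs ->
  carlier A gamma x xs @[gamma --> +oo] --> +oo.
Proof.
move=> xsA.
have [e e0 far] : exists2 e : R, 0 < e & forall v, ran A v -> e <= `|v - xs|.
  (* Without such an [e], every ball around [xs] would meet [ran A]. *)
  apply: contrapT => near_ran; apply: xsA => B /nbhs_ballP[e /= e0 eB].
  apply: contrapT => noB; apply: near_ran; exists e => // v Av.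
  rewrite leNgt; apply/negP => lt_e; apply: noB; exists v; split => //.
  by apply: eB; rewrite -ball_normE /= distrC.
apply/cvgryPge => M; near=> gamma.
have g0 : 0 < gamma by near: gamma; exact: nbhs_pinfty_gt.
(* This threshold suffices because the bound equals [gamma] times the square of [|v - xs|], which is
   at least [e]. *)
have Mg : M / e ^+ 2 <= gamma by near: gamma; apply: nbhs_pinfty_ge; rewrite num_real.
have [p [v [Av xp ->]]] := carlier_witness g0.
have ev : e <= `|v - xs| by apply: far; exists p.
rewrite xp normrZ gtr0_norm// exprMn mulrAC expr2 mulfK ?gt_eqF//.
move: Mg; rewrite ler_pdivrMr ?exprn_gt0// => /le_trans; apply.
by rewrite ler_pM2l// ler_pXn2r ?nnegrE// ltW.
Unshelve. all: by end_near. Qed.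

Lemma carlier_le (y : X) (gamma : R) : A y xs -> 0 < gamma ->
  0 <= carlier A gamma x xs <= `|x - y| ^+ 2 / gamma.
Proof.
move=> Ay g0; have [p [v [Av xp ->]]] := carlier_witness g0.
rewrite divr_ge0 ?sqr_ge0 ?(ltW g0)//= ler_pM2r ?invr_gt0//.
(* Monotonicity between [(p, v)] and [(y, xs)], scaled by [gamma]; expanding the square of
   [(p - y) + (x - p)] then bounds [|x - p|] by [|x - y|]. *)
have py : 0 <= dot (p - y) (x - p) by rewrite xp dotZr mulr_ge0 ?(ltW g0) ?hA.1.
have -> : x - y = (p - y) + (x - p) by rewrite [RHS]addrC addrA subrK.
move: (p - y) (x - p) py => a b ab.
rewrite !hdot !dotE (dotC dot b a); have := dotuu_ge0 hdot a.
by move: (dot a a : R) (dot a b : R) (dot b b : R) ab => c d e *; lra.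
Qed.

Lemma carlier_cvg0 : ran A xs -> carlier A gamma x xs @[gamma --> +oo] --> 0.
Proof.
move=> [y _ Ay].
apply: (@squeeze_cvgr _ _ _ _ (fun=> 0) (fun gamma => `|x - y| ^+ 2 / gamma)).
- by near=> gamma; apply: carlier_le => //; near: gamma; exact: nbhs_pinfty_gt.
- exact: cvg_cst.
- rewrite -[X in _ --> X](mulr0 (`|x - y| ^+ 2)); apply: cvgM; first exact: cvg_cst.
  by apply/(gtr0_cvgV0 (f := id)); [exact: nbhs_pinfty_gt|exact: cvg_id].
Unshelve. all: by end_near. Qed.

End CarlierBound.

Theorem corollary5p2 (R : realType) (X : completeNormedModType R)
    (dot : {dot X for idfun}) (hdot : induces_norm dot)
    (A : X -> set X) (hA : maximally_monotone dot A) (x xs : X) :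
  (~ closure (ran A) xs -> carlier A gamma x xs @[gamma --> +oo] --> +oo) /\
  (ran A xs -> carlier A gamma x xs @[gamma --> +oo] --> 0).
Proof. by split; [exact: carlier_cvg_pinfty hA x xs|exact: carlier_cvg0 hA x xs]. Qed.
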